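(* Let $d,m\ge 1$, let $\{f_i\}_{i=1}^m$ be an iterated function system of contractive similitudes on $\mathbb{R}^d$ with self-similar set $K$, and let $M\subseteq\mathbb{R}^d$ be a nonempty compact set with $f_i(M)\subseteq M$ for all $1\le i\le m$. Let $\Pi$ be the projection map, let $U$ be the univoque set of $K$, and let $\Gamma$ and $V$ be the set of words and the set of sequences determined by $\{f_i\}_{i=1}^m$ and $M$ as defined in the context. Then $$\dim_H U=\max\left\{\dim_H \Pi\left(\Gamma^{\mathbb{N}}\right),\ \dim_H \Pi\left(V\cap \Pi^{-1}(U)\right)\right\}.$$
   Context: IFS and self-similar set. $\Omega=\{1,\dots,m\}$ and $f_i(x)=r_iR_ix+b_i$ for $i\in\Omega$, where $0<r_i<1$, $R_i$ is an orthogonal transformation of $\mathbb{R}^d$ and $b_i\in\mathbb{R}^d$. The self-similar set $K$ is the unique nonempty compact set with $K=\bigcup_{i=1}^m f_i(K)$. (Any nonempty compact $M$ with $f_i(M)\subseteq M$ for all $i$ satisfies $K\subseteq M$.) Words. $\Omega^*=\bigcup_{n\ge1}\Omega^n$ is the set of finite nonempty words over $\Omega$. For $\mathbf{i}=i_1\cdots i_k\in\Omega^*$ put $f_{\mathbf{i}}=f_{i_1}\circ\cdots\circ f_{i_k}$. For $\mathbf{i}=(i_n)_{n\ge1}\in\Omega^{\mathbb{N}}$ put $\mathbf{i}|k=i_1\cdots i_k$. If $\mathcal{T}$ is a set of words of length $n$, then $\mathcal{T}\times\Omega$ is identified with the set of words of length $n+1$ obtained by appending a letter of $\Omega$ to a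 word of $\mathcal{T}$. Codings and univoque set. The surjective projection $\Pi:\Omega^{\mathbb{N}}\to K$ is $\Pi((i_n)_{n\ge1})=\lim_{n\to\infty}f_{i_1}\circ\cdots\circ f_{i_n}(0)$. A sequence $\mathbf{i}\in\Omega^{\mathbb{N}}$ with $\Pi(\mathbf{i})=x$ is called a coding of $x$. The univoque set $U$ is the set of $x\in K$ having exactly one coding. The sets $\Gamma$ and $V$. Given $M$, define $$\mathcal{S}_1=\{\mathbf{k}\in\Omega: f_{\mathbf{k}}(M)\cap f_{\mathbf{j}}(M)=\emptyset\ \text{for all}\ \mathbf{j}\in\Omega\setminus\{\mathbf{k}\}\},\qquad \mathcal{T}_1=\Omega\setminus\mathcal{S}_1,$$ and for $i\ge1$ $$\mathcal{S}_{i+1}=\{\mathbf{k}\in\mathcal{T}_i\times\Omega: f_{\mathbf{k}}(M)\cap f_{\mathbf{j}}(M)=\emptyset\ \text{for all}\ \mathbf{j}\in(\mathcal{T}_i\times\Omega)\setminus\{\mathbf{k}\}\},\qquad \mathcal{T}_{i+1}=(\mathcal{T}_i\times\Omega)\setminus\mathcal{S}_{i+1}.$$ Some $\mathcal{S}_i$ may be empty. Put $\Gamma=\bigcup_{i\ge1}\mathcal{S}_i\subseteq\Omega^*$. $\Gamma^{\mathbb{N}}$ denotes the set of all sequences in $\Omega^{\mathbb{N}}$ that are infinite concatenations of words from $\Gamma$. A sequence $\mathbf{i}\in\Omega^{\mathbb{N}}$ begins with $\Gamma$ if $\mathbf{i}|k\in\Gamma$ for some $k\in\mathbb{N}$, $k\geq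 1$. Put $V=\{\mathbf{i}\in\Omega^{\mathbb{N}}:\mathbf{i}\text{ does not begin with }\Gamma\}$. $\dim_H$ is Hausdorff dimension, with $\dim_H\emptyset=0$. *)

(* Defs.v *)
From HB Require Import structures.
From mathcomp Require Import all_boot all_order all_algebra.
From mathcomp Require Import all_classical all_reals all_analysis.
Set Implicit Arguments.
Unset Strict Implicit.
Unset Printing Implicit Defensive.
Import Order.TTheory GRing.Theory Num.Theory.
Import numFieldNormedType.Exports.
Local Open Scope classical_set_scope.
Local Open Scope ring_scope.

(* The norm that the library puts on matrices is the sup norm; diameters are
   taken here in the Euclidean norm.  Both induce the library's topology. *)
Definition enorm (R : realType) (d : nat) (x : 'cV[R]_d) : R :=
  Num.sqrt (\sum_(i < d) x i 0 ^+ 2).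

(* [ediam set0 = -oo]. *)
Definition ediam (R : realType) (d : nat) (A : set 'cV[R]_d) : \bar R :=
  ereal_sup [set (enorm (x - y))%:E | x in A & y in A].

(* |A|^s, with |set0|^s = 0 for every s >= 0 and |A|^0 = 1 otherwise. *)
Definition diam_pow (R : realType) (d : nat) (s : R) (A : set 'cV[R]_d)
    : \bar R :=
  if A == set0 then 0%E else (ediam A `^ s)%E.

Definition hausdorff_content (R : realType) (d : nat) (s delta : R)
    (A : set 'cV[R]_d) : \bar R :=
  ereal_inf [set (\sum_(0 <= n <oo) diam_pow s (F n))%E |
    F in [set F : nat -> set 'cV[R]_d |
      A `<=` \bigcup_n F n /\ forall n, (ediam (F n) <= delta%:E)%E]].

(* The supremum is the limit as delta tends to 0 from the right, the content
   being nonincreasing in delta. *)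
Definition hausdorff_measure (R : realType) (d : nat) (s : R)
    (A : set 'cV[R]_d) : \bar R :=
  ereal_sup [set hausdorff_content s delta A | delta in [set e : R | 0 < e]].

Definition hausdorff_dim (R : realType) (d : nat) (A : set 'cV[R]_d) : \bar R :=
  ereal_inf [set s%:E | s in
    [set s : R | 0 <= s /\ hausdorff_measure s A = 0%E]].

Definition contractive_similitude (R : realType) (d : nat)
    (g : 'cV[R]_d -> 'cV[R]_d) : Prop :=
  exists (r : R) (Q : 'M[R]_d) (b : 'cV[R]_d),
    [/\ 0 < r < 1, Q *m Q^T = 1%:M & forall x, g x = r *: (Q *m x) + b].

Definition self_similar_set (R : realType) (d m : nat)
    (f : 'I_m -> 'cV[R]_d -> 'cV[R]_d) (K : set 'cV[R]_d) : Prop :=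
  [/\ K !=set0, compact K & K = \bigcup_(i in [set: 'I_m]) (f i @` K)].

(* Words over Omega are lists [seq 'I_m]; sequences in Omega^N are functions
   [nat -> 'I_m], indexed from 0, and the prefix i|k is [mkseq i k]. *)

Definition word_map (R : realType) (d m : nat)
    (f : 'I_m -> 'cV[R]_d -> 'cV[R]_d) (w : seq 'I_m) : 'cV[R]_d -> 'cV[R]_d :=
  foldr (fun i g => f i \o g) id w.

Definition coding_map (R : realType) (d m : nat)
    (f : 'I_m -> 'cV[R]_d -> 'cV[R]_d) (i : nat -> 'I_m) : 'cV[R]_d :=
  lim ((fun n => word_map f (mkseq i n) 0) @ \oo).

Definition univoque (R : realType) (d m : nat)
    (f : 'I_m -> 'cV[R]_d -> 'cV[R]_d) (K : set 'cV[R]_d) : set 'cV[R]_d :=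
  [set x | K x /\ exists! i : nat -> 'I_m, coding_map f i = x].

Definition append_letter (m : nat) (W : set (seq 'I_m)) : set (seq 'I_m) :=
  [set rcons w i | w in W & i in [set: 'I_m]].

Definition isolated_words (R : realType) (d m : nat)
    (f : 'I_m -> 'cV[R]_d -> 'cV[R]_d) (M : set 'cV[R]_d)
    (W : set (seq 'I_m)) : set (seq 'I_m) :=
  [set k | W k /\ forall j, (W `\ k) j ->
    (word_map f k @` M) `&` (word_map f j @` M) = set0].

(* T_n; starting from T_0 = {empty word}, so that T_0 x Omega = Omega, makes
   the general step produce S_1 and T_1 as well. *)
Fixpoint T_words (R : realType) (d m : nat)
    (f : 'I_m -> 'cV[R]_d -> 'cV[R]_d) (M : set 'cV[R]_d) (n : nat)
    : set (seq 'I_m) :=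
  if n is n'.+1 then
    append_letter (T_words f M n') `\`
      isolated_words f M (append_letter (T_words f M n'))
  else [set [::]].

(* [S_words f M n] is S_(n+1). *)
Definition S_words (R : realType) (d m : nat)
    (f : 'I_m -> 'cV[R]_d -> 'cV[R]_d) (M : set 'cV[R]_d) (n : nat)
    : set (seq 'I_m) :=
  isolated_words f M (append_letter (T_words f M n)).

Definition Gamma_words (R : realType) (d m : nat)
    (f : 'I_m -> 'cV[R]_d -> 'cV[R]_d) (M : set 'cV[R]_d) : set (seq 'I_m) :=
  \bigcup_n S_words f M n.

(* Infinite concatenations w_0 w_1 w_2 ... of words of W: each finite
   concatenation w_0 ... w_(n-1) is a prefix of i.  This determines i as soon
   as W does not contain the empty word, which is the case of [Gamma_words]. *)
Definition concatenations (m : nat) (W : set (seq 'I_m)) : set (nat -> 'I_m) :=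
  [set i | exists w : nat -> seq 'I_m, (forall n, W (w n)) /\
    forall n, mkseq i (size (flatten (mkseq w n))) = flatten (mkseq w n)].

Definition begins_with (m : nat) (W : set (seq 'I_m)) (i : nat -> 'I_m) : Prop :=
  exists k : nat, (1 <= k)%N /\ W (mkseq i k).

Definition V_seqs (R : realType) (d m : nat)
    (f : 'I_m -> 'cV[R]_d -> 'cV[R]_d) (M : set 'cV[R]_d) : set (nat -> 'I_m) :=
  [set i | ~ begins_with (Gamma_words f M) i].

(* Main.v *)
(* Two words of Gamma have disjoint images of M unless they coincide, so any
   coding of a point with a coding in Gamma^N starts with the same word of
   Gamma; peeling it off repeatedly shows that the point is univoque.
   Conversely, if no tail of a sequence i lies in V, then i is cut into words of
   Gamma; otherwise the coded point is f_w(y) with w a finite prefix of i and y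
   coded by a tail in V, and y is univoque when the point is.  Hence U contains
   Pi(Gamma^N) and Pi(V & Pi^-1 U), and is covered by Pi(Gamma^N) and the
   countably many sets f_w(Pi(V & Pi^-1 U)); Hausdorff dimension is countably
   stable and does not increase under the nonexpansive maps f_w. *)
Require Import Defs.
From HB Require Import structures.
From mathcomp Require Import all_boot all_order all_algebra.
From mathcomp Require Import all_classical all_reals all_analysis.
Set Implicit Arguments.
Unset Strict Implicit.
Unset Printing Implicit Defensive.
Import Order.TTheory GRing.Theory Num.Theory.
Import numFieldNormedType.Exports.
Local Open Scope classical_set_scope.
Local Open Scope ring_scope.

(** * Sets of zero Hausdorff measure *)

Lemma diam_pow_ge0 (R : realType) (d : nat) (s : R) (A : set 'cV[R]_d) :
  (0 <= diam_pow s A)%E.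
Proof. by rewrite /diam_pow; case: ifPn => // _; exact: poweR_ge0. Qed.

Lemma enorm_ge0 (R : realType) (d : nat) (x : 'cV[R]_d) : 0 <= enorm x.
Proof. exact: sqrtr_ge0. Qed.

Lemma ediam_ge0 (R : realType) (d : nat) (A : set 'cV[R]_d) :
  A !=set0 -> (0 <= ediam A)%E.
Proof.
case=> x Ax; apply: (@le_trans _ _ (enorm (x - x))%:E).
  by rewrite lee_fin enorm_ge0.
by apply: ereal_sup_ubound; exists x => //; exists x.
Qed.

Lemma diam_pow_le_exponent (R : realType) (d : nat) (s t : R) (A : set 'cV[R]_d) :
  0 <= s -> s <= t -> (ediam A <= 1)%E -> (diam_pow t A <= diam_pow s A)%E.
Proof.
move=> s0 st; rewrite /diam_pow; case: ifPn => // /set0P /ediam_ge0.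
case: (ediam A) => //= x; rewrite !lee_fin => x0 x1.
have [xz|x_gt0] := eqVneq x 0; last first.
  have x01 : 0 < x <= 1 by rewrite lt0r x_gt0 x0 x1.
  exact: (ger_powR x01).
(* Zero diameter: since 0^0 = 1, the exponent [t = 0] is separate, and there [s = t]. *)
rewrite xz; case: (eqVneq t 0) => [t0|t0]; last by rewrite powR0// powR_ge0.
by have -> : s = t by apply/eqP; rewrite eq_le st t0 s0.
Qed.

(** Vanishing of [hausdorff_measure s A] in terms of covers, so that later arguments construct
    covers instead of handling infima and suprema. *)
Definition hausdorff_null (R : realType) (d : nat) (s : R) (A : set 'cV[R]_d) :=
  forall delta eps : R, 0 < delta -> 0 < eps ->
  exists F : nat -> set 'cV[R]_d,
    [/\ A `<=` \bigcup_n F n, forall n, (ediam (F n) <= delta%:E)%E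
      & (\sum_(0 <= n <oo) diam_pow s (F n) <= eps%:E)%E].

Lemma hausdorff_content_ge0 (R : realType) (d : nat) (s delta : R)
    (A : set 'cV[R]_d) : (0 <= hausdorff_content s delta A)%E.
Proof.
apply: le_ereal_inf_tmp => _ [F _ <-].
by apply: nneseries_ge0 => n _ _; exact: diam_pow_ge0.
Qed.

Lemma hausdorff_measure_eq0 (R : realType) (d : nat) (s : R) (A : set 'cV[R]_d) :
  hausdorff_measure s A = 0%E <-> hausdorff_null s A.
Proof.
split=> [m0 delta eps d0 e0|nA].
  have c0 : hausdorff_content s delta A = 0%E.
    apply/eqP; rewrite eq_le hausdorff_content_ge0 andbT -m0.
    by apply: ereal_sup_ubound; exists delta.
  have fc : hausdorff_content s delta A \is a fin_num by rewrite c0.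
  have [_ [F [AF dF] <-]] := lb_ereal_inf_adherent e0 fc.
  rewrite -/(hausdorff_content s delta A) c0 add0e => /ltW leF.
  by exists F.
apply/eqP; rewrite eq_le; apply/andP; split.
  apply: ge_ereal_sup => _ [delta /= d0 <-]; apply/lee_addgt0Pr => eps e0.
  rewrite add0e; have [F [AF dF leF]] := nA _ _ d0 e0.
  by apply: le_trans leF; apply: ereal_inf_lbound; exists F.
apply: (le_trans (hausdorff_content_ge0 s 1 A)).
by apply: ereal_sup_ubound; exists 1 => //=.
Qed.

Lemma hausdorff_null_subset (R : realType) (d : nat) (s : R) (A B : set 'cV[R]_d) :
  A `<=` B -> hausdorff_null s B -> hausdorff_null s A.
Proof.
move=> AB nB delta eps d0 e0; have [F [BF dF leF]] := nB _ _ d0 e0.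
by exists F; split=> //; exact: subset_trans BF.
Qed.

Lemma hausdorff_null_le_exponent (R : realType) (d : nat) (s t : R)
    (A : set 'cV[R]_d) :
  0 <= s -> s <= t -> hausdorff_null s A -> hausdorff_null t A.
Proof.
move=> s0 st nA delta eps d0 e0.
(* Cutting the mesh down to at most 1 makes [diam_pow] nonincreasing in the exponent on every
   covering set. *)
have m0 : 0 < Num.min delta 1 by rewrite lt_min d0 ltr01.
have [F [AF dF leF]] := nA _ _ m0 e0; exists F; split=> // [n|].
  by apply: le_trans (dF n) _; rewrite lee_fin ge_min lexx.
apply: le_trans leF; apply: lee_nneseries => [n _ _|n _].
  exact: diam_pow_ge0.
apply: diam_pow_le_exponent => //; apply: le_trans (dF n) _.
by rewrite lee_fin ge_min lexx orbT.
Qed.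

Definition nonexpansive (R : realType) (d : nat) (g : 'cV[R]_d -> 'cV[R]_d) :=
  forall x y, enorm (g x - g y) <= enorm (x - y).

Lemma ediam_image_nonexpansive (R : realType) (d : nat)
    (g : 'cV[R]_d -> 'cV[R]_d) (A : set 'cV[R]_d) :
  nonexpansive g -> (ediam (g @` A) <= ediam A)%E.
Proof.
move=> gN; apply: ge_ereal_sup => _ [_ [x Ax <-] [_ [y Ay <-] <-]].
apply: (@le_trans _ _ (enorm (x - y))%:E); first by rewrite lee_fin gN.
by apply: ereal_sup_ubound; exists x => //; exists y.
Qed.

Lemma diam_pow_image_nonexpansive (R : realType) (d : nat) (s : R)
    (g : 'cV[R]_d -> 'cV[R]_d) (A : set 'cV[R]_d) :
  0 <= s -> nonexpansive g -> (diam_pow s (g @` A) <= diam_pow s A)%E.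
Proof.
move=> s0 gN; rewrite /diam_pow.
have [->|A0] := eqVneq A set0; first by rewrite image_set0 eqxx.
have /set0P A0' := A0; have gA0 : g @` A !=set0 by exact: image_nonempty.
rewrite ifF; last by apply/negbTE/set0P.
apply: gt0_ler_poweR => //; last exact: ediam_image_nonexpansive.
- by rewrite in_itv /= leey andbT ediam_ge0.
- by rewrite in_itv /= leey andbT ediam_ge0.
Qed.

Lemma hausdorff_null_image (R : realType) (d : nat) (s : R)
    (g : 'cV[R]_d -> 'cV[R]_d) (A : set 'cV[R]_d) :
  0 <= s -> nonexpansive g -> hausdorff_null s A -> hausdorff_null s (g @` A).
Proof.
move=> s0 gN nA delta eps d0 e0; have [F [AF dF leF]] := nA _ _ d0 e0.
exists (fun n => g @` F n); split.
- by move=> _ [x /AF[n _ Fx] <-]; exists n => //; exists x.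
- by move=> n; apply: le_trans (dF n); exact: ediam_image_nonexpansive.
apply: le_trans leF; apply: lee_nneseries => [n _ _|n _].
  exact: diam_pow_ge0.
exact: diam_pow_image_nonexpansive.
Qed.

(** The [n]-th set is covered at cost at most [eps / 2^(n+1)], and the double sequence of covering
    sets is enumerated by a bijection from [nat] to [nat * nat]. *)
Lemma hausdorff_null_bigcup (R : realType) (d : nat) (s : R)
    (A : nat -> set 'cV[R]_d) :
  (forall n, hausdorff_null s (A n)) -> hausdorff_null s (\bigcup_n A n).
Proof.
move=> nA delta eps d0 e0.
have en0 n : 0 < eps / (2 ^ n.+1)%:R.
  by rewrite divr_gt0// ltr0n expn_gt0.
have /choice[G PG] := fun n => nA n delta _ d0 (en0 n).
have /card_esym/ppcard_eqP[f] := card_nat2.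
exists (uncurry G \o f); split.
- move=> x [n _ Anx]; have [AG _ _] := PG n; have [k _ Gx] := AG _ Anx.
  by exists (f^-1%FUN (n, k)) => //=; rewrite invK ?inE.
- by move=> n /=; case: (f n) => a b; have [_ + _] := PG a; exact.
(* All terms are nonnegative, so the series equals an unordered sum, which can be reindexed over
   pairs and then summed row by row. *)
rewrite nneseries_esumT; last by move=> n; exact: diam_pow_ge0.
rewrite -(reindex_esum setT setT f (fun p => diam_pow s (uncurry G p)))//.
have -> : [set: nat * nat] = [set: nat] `*`` (fun=> [set: nat]).
  by apply/seteqP; split.
have -> : (fun p => diam_pow s (uncurry G p)) = (fun p => diam_pow s (G p.1 p.2)).
  by apply/funext => -[].
rewrite -(esum_esum (a := fun a b => diam_pow s (G a b))); last first.
  by move=> *; exact: diam_pow_ge0.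
rewrite -nneseries_esumT; last by move=> n; apply: esum_ge0 => *; exact: diam_pow_ge0.
apply: le_trans (epsilon_trick0 xpredT (ltW e0)).
apply: lee_nneseries => [n _ _|n _]; first by apply: esum_ge0 => *; exact: diam_pow_ge0.
rewrite -nneseries_esumT; last by move=> k; exact: diam_pow_ge0.
by have [] := PG n.
Qed.

Lemma hausdorff_null_bigcup_count (R : realType) (d : nat) (s : R)
    (T : countType) (A : T -> set 'cV[R]_d) :
  (forall t, hausdorff_null s (A t)) -> hausdorff_null s (\bigcup_t A t).
Proof.
move=> nA; apply: (@hausdorff_null_subset _ _ _ _
  (\bigcup_n oapp A set0 (unpickle n))).
  by move=> x [t _ Atx]; exists (pickle t) => //; rewrite pickleK.
(* A number that encodes no index contributes the empty set, covered by empty sets of diameter [-oo]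
   and cost 0. *)
apply: hausdorff_null_bigcup => n; case: (unpickle n) => //= delta eps d0 e0.
exists (fun=> set0); split=> // [_|].
  by apply: ge_ereal_sup => _ [x []].
by rewrite eseries0 ?lee_fin ?ltW// => k _ _; rewrite /diam_pow eqxx.
Qed.

(** * Monotonicity and countable stability of Hausdorff dimension *)

Lemma hausdorff_dim_ge0 (R : realType) (d : nat) (A : set 'cV[R]_d) :
  (0 <= hausdorff_dim A)%E.
Proof. by apply: le_ereal_inf_tmp => _ [s [s0 _] <-]; rewrite lee_fin. Qed.

Lemma hausdorff_dim_le_of_null (R : realType) (d : nat) (s : R)
    (A : set 'cV[R]_d) :
  0 <= s -> hausdorff_null s A -> (hausdorff_dim A <= s%:E)%E.
Proof.
move=> s0 nA; apply: ereal_inf_lbound; exists s => //; split=> //.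
exact/hausdorff_measure_eq0.
Qed.

Lemma hausdorff_null_of_dim_lt (R : realType) (d : nat) (s : R)
    (A : set 'cV[R]_d) :
  (hausdorff_dim A < s%:E)%E -> hausdorff_null s A.
Proof.
move=> /ereal_inf_lt[_ [t [t0 /hausdorff_measure_eq0 nA] <-]].
by rewrite lte_fin => /ltW ts; exact: hausdorff_null_le_exponent nA.
Qed.

Lemma hausdorff_dim_subset (R : realType) (d : nat) (A B : set 'cV[R]_d) :
  A `<=` B -> (hausdorff_dim A <= hausdorff_dim B)%E.
Proof.
move=> AB; apply: le_ereal_inf_tmp => _ [s [s0 /hausdorff_measure_eq0 nB] <-].
by apply: hausdorff_dim_le_of_null => //; exact: hausdorff_null_subset nB.
Qed.

Lemma hausdorff_dim_image (R : realType) (d : nat)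
    (g : 'cV[R]_d -> 'cV[R]_d) (A : set 'cV[R]_d) :
  nonexpansive g -> (hausdorff_dim (g @` A) <= hausdorff_dim A)%E.
Proof.
move=> gN; apply: le_ereal_inf_tmp => _ [s [s0 /hausdorff_measure_eq0 nA] <-].
by apply: hausdorff_dim_le_of_null => //; exact: hausdorff_null_image.
Qed.

Lemma hausdorff_dim_bigcup_le (R : realType) (d : nat) (T : countType)
    (A : T -> set 'cV[R]_d) (D : \bar R) :
  (0 <= D)%E -> (forall t, hausdorff_dim (A t) <= D)%E ->
  (hausdorff_dim (\bigcup_t A t) <= D)%E.
Proof.
case: D => [D|_ _|//]; last by rewrite leey.
(* A piece of dimension exactly [D] may have positive measure at exponent [D], but every piece is
   null at [D + e]. *)
rewrite lee_fin => D0 dA; apply/lee_addgt0Pr => e e0; rewrite -EFinD.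
apply: hausdorff_dim_le_of_null; first by rewrite addr_ge0// ltW.
apply: hausdorff_null_bigcup_count => t; apply: hausdorff_null_of_dim_lt.
by apply: le_lt_trans (dA t) _; rewrite lte_fin ltrDl.
Qed.

(** * Euclidean norm, similitudes and their compositions *)

Lemma enorm_sqr (R : realType) (d : nat) (x : 'cV[R]_d) :
  enorm x ^+ 2 = (x^T *m x) 0 0.
Proof.
rewrite sqr_sqrtr; last by apply: sumr_ge0 => i _; exact: sqr_ge0.
by rewrite mxE; apply: eq_bigr => i _; rewrite mxE expr2.
Qed.

Lemma enorm_orthogonal (R : realType) (d : nat) (Q : 'M[R]_d) (x : 'cV[R]_d) :
  Q *m Q^T = 1%:M -> enorm (Q *m x) = enorm x.
Proof.
move=> /mulmx1C QTQ; apply/eqP.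
rewrite -(@eqrXn2 _ 2) ?enorm_ge0// !enorm_sqr trmx_mul -mulmxA (mulmxA Q^T).
by rewrite QTQ mul1mx.
Qed.

Lemma enormZ (R : realType) (d : nat) (r : R) (x : 'cV[R]_d) :
  0 <= r -> enorm (r *: x) = r * enorm x.
Proof.
move=> r0; apply/eqP; rewrite -(@eqrXn2 _ 2) ?mulr_ge0 ?enorm_ge0//.
by rewrite exprMn !enorm_sqr -scalemxAr [(_ *: _)^T]linearZ /= -scalemxAl !mxE mulrA -expr2.
Qed.

(** With [enorm_le_norm], this carries Euclidean estimates over to the topology of the sup norm. *)
Lemma norm_le_enorm (R : realType) (d : nat) (x : 'cV[R]_d) : `|x| <= enorm x.
Proof.
rewrite [leLHS]/Num.Def.normr /= mx_normrE; apply: bigmax_le => [|[i j] _ /=].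
  exact: enorm_ge0.
rewrite (ord1 j) -sqrtr_sqr ler_wsqrtr// (bigD1 i)//= lerDl.
by apply: sumr_ge0 => k _; exact: sqr_ge0.
Qed.

Lemma enorm_le_norm (R : realType) (d : nat) (x : 'cV[R]_d) :
  enorm x <= Num.sqrt d%:R * `|x|.
Proof.
rewrite -(ger0_norm (normr_ge0 x)) -sqrtr_sqr -sqrtrM ?ler0n// ler_wsqrtr//.
have -> : d%:R * `|x| ^+ 2 = \sum_(i < d) `|x| ^+ 2.
  by rewrite sumr_const card_ord mulr_natl.
apply: ler_sum => i _.
rewrite -real_normK ?num_real// lerXn2r ?nnegrE//.
rewrite [leRHS]/Num.Def.normr /= mx_normrE.
by apply: (le_bigmax _ (fun ij => `|x ij.1 ij.2|) (i, 0)).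
Qed.

Lemma contractive_similitude_ratio (R : realType) (d : nat)
    (g : 'cV[R]_d -> 'cV[R]_d) :
  contractive_similitude g ->
  exists r : R, 0 < r < 1 /\ forall x y, enorm (g x - g y) = r * enorm (x - y).
Proof.
move=> [r [Q [b [/andP[r0 r1] QQ gE]]]]; exists r; split=> [|x y].
  by rewrite r0.
by rewrite !gE opprD addrACA subrr addr0 -scalerBr -mulmxBr enormZ ?(ltW r0)// enorm_orthogonal.
Qed.

Lemma enorm_eq0 (R : realType) (d : nat) (x : 'cV[R]_d) : enorm x = 0 -> x = 0.
Proof.
by move=> x0; apply/normr0_eq0/le_anti; rewrite normr_ge0 -x0 norm_le_enorm.
Qed.

Lemma enorm0 (R : realType) (d : nat) : enorm (0 : 'cV[R]_d) = 0.
Proof. by rewrite -(scale0r (0 : 'cV[R]_d)) enormZ// mul0r. Qed.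

Lemma contractive_similitude_inj (R : realType) (d : nat)
    (g : 'cV[R]_d -> 'cV[R]_d) : contractive_similitude g -> injective g.
Proof.
move=> /contractive_similitude_ratio[r [/andP[r0 _] gr]] x y gxy.
apply/subr0_eq/enorm_eq0/(mulfI (lt0r_neq0 r0)).
by rewrite -gr gxy subrr enorm0 mulr0.
Qed.

Lemma word_map_contraction (R : realType) (d m : nat)
    (f : 'I_m -> 'cV[R]_d -> 'cV[R]_d) :
  (forall i, contractive_similitude (f i)) ->
  exists rho : R, 0 <= rho < 1 /\ forall w x y,
    enorm (word_map f w x - word_map f w y) <= rho ^+ size w * enorm (x - y).
Proof.
move=> hf; have /choice[r rP] := fun i => contractive_similitude_ratio (hf i).
(* The alphabet is finite, so the largest ratio is still below 1 and serves every letter. *)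
pose rho := \big[Num.max/0]_i r i.
have rho0 : 0 <= rho by exact: bigmax_ge_id.
exists rho; split=> [|w x y].
  rewrite rho0; apply: bigmax_lt; rewrite ?ltr01// => i _.
  by have [/andP[]] := rP i.
elim: w => [|i w IH] /=; first by rewrite expr0 mul1r.
have [/andP[r0 _] ->] := rP i; rewrite exprS -mulrA.
by apply: ler_pM => //; [exact: ltW|exact: enorm_ge0|exact: le_bigmax].
Qed.

Lemma word_map_nonexpansive (R : realType) (d m : nat)
    (f : 'I_m -> 'cV[R]_d -> 'cV[R]_d) (w : seq 'I_m) :
  (forall i, contractive_similitude (f i)) -> nonexpansive (word_map f w).
Proof.
move=> /word_map_contraction[rho [/andP[rho0 rho1] frho]] x y.
apply: le_trans (frho w x y) _; apply: ler_piMl; first exact: enorm_ge0.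
by rewrite exprn_ile1// ltW.
Qed.

Lemma word_map_inj (R : realType) (d m : nat)
    (f : 'I_m -> 'cV[R]_d -> 'cV[R]_d) (w : seq 'I_m) :
  (forall i, contractive_similitude (f i)) -> injective (word_map f w).
Proof.
move=> hf; elim: w => [|i w IH] x y //= /(contractive_similitude_inj (hf i)).
exact: IH.
Qed.

Lemma nonexpansive_continuous (R : realType) (d : nat)
    (g : 'cV[R]_d -> 'cV[R]_d) : nonexpansive g -> continuous g.
Proof.
move=> gN x; apply/(cvgrPdist_lt (FF := nbhs_filter x)) => e e0.
(* The added 1 makes the comparison constant positive for every [d], so that [e] can be divided by
   it. *)
have c0 : 0 < Num.sqrt d%:R + 1 :> R by rewrite ltr_wpDl ?sqrtr_ge0.
near=> y; apply: le_lt_trans (norm_le_enorm _) _.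
apply: le_lt_trans (gN _ _) _; apply: le_lt_trans (enorm_le_norm _) _.
apply: (@le_lt_trans _ _ ((Num.sqrt d%:R + 1) * `|x - y|)).
  by rewrite ler_wpM2r// lerDl.
rewrite mulrC -ltr_pdivlMr//; near: y.
have ec0 : 0 < e / (Num.sqrt d%:R + 1) by rewrite divr_gt0.
by have := nbhsx_ballx x _ ec0; rewrite -ball_normE.
Unshelve. all: by end_near. Qed.

(** * Prefixes, invariant compact sets and the coding map *)

Lemma word_map_cat (R : realType) (d m : nat)
    (f : 'I_m -> 'cV[R]_d -> 'cV[R]_d) (u v : seq 'I_m) (x : 'cV[R]_d) :
  word_map f (u ++ v) x = word_map f u (word_map f v x).
Proof. by elim: u => //= i u ->. Qed.

Definition shift (T : Type) (p : nat) (i : nat -> T) : nat -> T :=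
  fun n => i (p + n)%N.

Lemma mkseqD (T : Type) (i : nat -> T) (p n : nat) :
  mkseq i (p + n) = mkseq i p ++ mkseq (shift p i) n.
Proof.
rewrite /mkseq iotaD map_cat add0n; congr (_ ++ _).
by rewrite -{1}[p]addn0 iotaDl -map_comp.
Qed.

(** Satisfied by both [M] and [K], so the facts on codings apply to either set. *)
Definition invariant_compact (R : realType) (d m : nat)
    (f : 'I_m -> 'cV[R]_d -> 'cV[R]_d) (M : set 'cV[R]_d) :=
  [/\ M !=set0, compact M & forall i, f i @` M `<=` M].

Lemma word_map_invariant (R : realType) (d m : nat)
    (f : 'I_m -> 'cV[R]_d -> 'cV[R]_d) (M : set 'cV[R]_d) (w : seq 'I_m) :
  invariant_compact f M -> word_map f w @` M `<=` M.
Proof.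
case=> _ _ fM; elim: w => [|i w IH] _ [x Mx <-] //=.
by apply: (fM i); exists (word_map f w x) => //; apply: IH; exists x.
Qed.

(** The images of [M] under the prefixes of [i] are nested compact sets; a cluster point of the
    images of one [z] in [M] lies in all of them. *)
Lemma prefix_images_meet (R : realType) (d m : nat)
    (f : 'I_m -> 'cV[R]_d -> 'cV[R]_d) (M : set 'cV[R]_d) (i : nat -> 'I_m) :
  (forall i, contractive_similitude (f i)) -> invariant_compact f M ->
  exists p, forall n, (word_map f (mkseq i n) @` M) p.
Proof.
move=> hf invM; have [[z Mz] cM fM] := invM.
pose u n := word_map f (mkseq i n) z.
have FM : (u @ \oo) M.
  exists 0%N => // n _.
  by apply: (word_map_invariant (w := mkseq i n) invM); exists z.
have [p [_ pu]] := cM _ _ FM; exists p => n.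
have clM : closed (word_map f (mkseq i n) @` M).
  apply: compact_closed; first exact: norm_hausdorff.
  apply: continuous_compact => //; apply: continuous_subspaceT.
  exact/nonexpansive_continuous/word_map_nonexpansive.
(* From index [n] on, the points [u k] lie in the [n]-th image, which is closed and so contains
   their cluster point. *)
apply: clM => B pB; apply: pu pB; exists n => // k /= nk.
rewrite -(subnKC nk) /u mkseqD word_map_cat.
exists (word_map f (mkseq (shift n i) (k - n)) z) => //.
by apply: (word_map_invariant invM); exists z.
Qed.

(** Write [p] as the image of some [q] in [M] under the [n]-th prefix: its distance to the image of
    0 is at most [rho ^+ n * enorm q], and [M] is bounded. This identifies the limit by membership
    alone. *)
Lemma coding_map_unique (R : realType) (d m : nat)
    (f : 'I_m -> 'cV[R]_d -> 'cV[R]_d) (M : set 'cV[R]_d) (i : nat -> 'I_m)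
    (p : 'cV[R]_d) :
  (forall i, contractive_similitude (f i)) -> invariant_compact f M ->
  (forall n, (word_map f (mkseq i n) @` M) p) -> coding_map f i = p.
Proof.
move=> hf [_ cM _] pM; have [rho [/andP[rho0 rho1] frho]] := word_map_contraction hf.
have [c [_ cP]] := compact_bounded cM.
have {}cP : forall q, M q -> `|q| <= `|c| + 1.
  by apply: cP; rewrite (le_lt_trans (ler_norm c))// ltrDl.
apply: cvg_lim; first exact: norm_hausdorff.
(* This constant bounds [enorm] on [M]: the sup norm there is at most [|c| + 1]. *)
have C0 : 0 <= Num.sqrt d%:R * (`|c| + 1) :> R.
  by rewrite mulr_ge0 ?sqrtr_ge0// addr_ge0.
apply/cvgrPdist_lt => e e0.
have := cvg_geometric (Num.sqrt d%:R * (`|c| + 1)) (z := rho).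
rewrite ger0_norm// => /(_ rho1) /cvgr0Pnorm_lt /(_ _ e0); apply: filterS => n.
rewrite /= ger0_norm ?mulr_ge0 ?exprn_ge0//; apply: le_lt_trans.
have [q Mq <-] := pM n; apply: le_trans (norm_le_enorm _) _.
apply: le_trans (frho _ _ _) _; rewrite size_mkseq subr0 mulrC.
apply: ler_wpM2r; first exact: exprn_ge0.
apply: le_trans (enorm_le_norm _) _.
by apply: ler_wpM2l; [exact: sqrtr_ge0|exact: cP].
Qed.

Lemma coding_map_prefix (R : realType) (d m : nat)
    (f : 'I_m -> 'cV[R]_d -> 'cV[R]_d) (M : set 'cV[R]_d) (i : nat -> 'I_m)
    (n : nat) :
  (forall i, contractive_similitude (f i)) -> invariant_compact f M ->
  (word_map f (mkseq i n) @` M) (coding_map f i).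
Proof.
move=> hf invM; have [p pM] := prefix_images_meet i hf invM.
by rewrite (coding_map_unique hf invM pM).
Qed.

Lemma coding_map_mem (R : realType) (d m : nat)
    (f : 'I_m -> 'cV[R]_d -> 'cV[R]_d) (M : set 'cV[R]_d) (i : nat -> 'I_m) :
  (forall i, contractive_similitude (f i)) -> invariant_compact f M ->
  M (coding_map f i).
Proof. by move=> hf invM; have [x Mx /= <-] := coding_map_prefix i 0 hf invM. Qed.

Lemma coding_map_shift (R : realType) (d m : nat)
    (f : 'I_m -> 'cV[R]_d -> 'cV[R]_d) (M : set 'cV[R]_d) (i : nat -> 'I_m)
    (p : nat) :
  (forall i, contractive_similitude (f i)) -> invariant_compact f M ->
  coding_map f i = word_map f (mkseq i p) (coding_map f (shift p i)).
Proof.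
move=> hf invM; apply: (coding_map_unique hf invM) => n.
(* A prefix of length at most [p] leaves a remaining word that maps [M] into itself; a longer one
   continues with a prefix of the shifted sequence. *)
have [np|/ltnW pn] := leqP n p.
  rewrite -(subnKC np) mkseqD word_map_cat.
  eexists; last reflexivity.
  apply: (word_map_invariant invM); eexists; last reflexivity.
  exact: coding_map_mem.
have [q Mq <-] := coding_map_prefix (shift p i) (n - p) hf invM.
by exists q => //; rewrite -word_map_cat -mkseqD subnKC.
Qed.

(** * Words of Gamma as forced prefixes of codings *)

Lemma append_letterS (m : nat) (W : set (seq 'I_m)) (i : nat -> 'I_m) (n : nat) :
  append_letter W (mkseq i n.+1) <-> W (mkseq i n).
Proof.
rewrite mkseqS; split=> [[w Ww [a _ /rcons_inj[<- _]]]//|Wi].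
by exists (mkseq i n) => //; exists (i n).
Qed.

Lemma T_words_prefix (R : realType) (d m : nat)
    (f : 'I_m -> 'cV[R]_d -> 'cV[R]_d) (M : set 'cV[R]_d) (i : nat -> 'I_m)
    (n k : nat) :
  (k <= n)%N -> T_words f M n (mkseq i n) -> T_words f M k (mkseq i k).
Proof.
elim: n => [|n IH]; first by rewrite leqn0 => /eqP ->.
by rewrite leq_eqVlt => /orP[/eqP -> //|kn] [/append_letterS /(IH kn)].
Qed.

Lemma size_T_words (R : realType) (d m : nat)
    (f : 'I_m -> 'cV[R]_d -> 'cV[R]_d) (M : set 'cV[R]_d) (n : nat)
    (w : seq 'I_m) :
  T_words f M n w -> size w = n.
Proof.
by elim: n w => [|n IH] w /=; [move->|move=> [[v /IH <- [a _ <-]] _]; rewrite size_rcons].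
Qed.

Lemma size_S_words (R : realType) (d m : nat)
    (f : 'I_m -> 'cV[R]_d -> 'cV[R]_d) (M : set 'cV[R]_d) (n : nat)
    (w : seq 'I_m) :
  S_words f M n w -> size w = n.+1.
Proof. by move=> [[v /size_T_words <- [a _ <-]] _]; rewrite size_rcons. Qed.

(** The common coded point lies in the images of [M] under both prefixes, which isolation makes
    disjoint if the prefixes differ. *)
Lemma isolated_words_coding (R : realType) (d m : nat)
    (f : 'I_m -> 'cV[R]_d -> 'cV[R]_d) (M : set 'cV[R]_d) (W : set (seq 'I_m))
    (i j : nat -> 'I_m) (n : nat) :
  (forall i, contractive_similitude (f i)) -> invariant_compact f M ->
  coding_map f i = coding_map f j ->
  isolated_words f M W (mkseq i n) -> W (mkseq j n) -> mkseq j n = mkseq i n.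
Proof.
move=> hf invM ij [_ iso] Wj; apply: contrapT => ji.
have /seteqP[/(_ (coding_map f i)) + _] := iso _ (conj Wj ji); apply.
by split; [|rewrite ij]; exact: coding_map_prefix.
Qed.

(* If [j|l] were isolated at an earlier generation than [i], it would equal
   [i|l]; but [i|l] is in T_l, so it is not isolated.  Hence the prefixes of [j]
   survive up to the generation in which the prefix of [i] is isolated, where
   both prefixes compete. *)
Lemma Gamma_prefix_coding (R : realType) (d m : nat)
    (f : 'I_m -> 'cV[R]_d -> 'cV[R]_d) (M : set 'cV[R]_d) (i j : nat -> 'I_m)
    (n : nat) :
  (forall i, contractive_similitude (f i)) -> invariant_compact f M ->
  coding_map f i = coding_map f j ->
  Gamma_words f M (mkseq i n) -> mkseq j n = mkseq i n.
Proof.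
move=> hf invM ij [k _ Sk].
have nk := size_S_words Sk; rewrite size_mkseq in nk; subst n.
have [/append_letterS Ti _] := Sk.
suff Tj : T_words f M k (mkseq j k).
  by apply: isolated_words_coding Sk _ => //; exact/append_letterS.
suff Tjl l : (l <= k)%N -> T_words f M l (mkseq j l) by exact: Tjl.
elim: l => [//|l IH lk]; have Tl := IH (ltnW lk).
split; first exact/append_letterS.
move=> isoj; have [Wi niso] := T_words_prefix lk Ti.
by apply: niso; rewrite (isolated_words_coding hf invM (esym ij) isoj Wi).
Qed.

Lemma concatenations_coding_inj (R : realType) (d m : nat)
    (f : 'I_m -> 'cV[R]_d -> 'cV[R]_d) (M : set 'cV[R]_d) (i j : nat -> 'I_m) :
  (forall i, contractive_similitude (f i)) -> invariant_compact f M ->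
  concatenations (Gamma_words f M) i ->
  coding_map f i = coding_map f j -> i = j.
Proof.
move=> hf invM [w [Gw iw]] ij.
(* The cut points of [i]; the induction shows that [j] agrees with [i] up to each of them. *)
pose p n := size (flatten (mkseq w n)).
have pS n : p n.+1 = (p n + size (w n))%N.
  by rewrite /p mkseqS flatten_rcons size_cat.
have eqp n : mkseq j (p n) = mkseq i (p n).
  elim: n => [//|n IH]; rewrite pS !mkseqD IH; congr (_ ++ _).
  apply: (Gamma_prefix_coding hf invM).
    (* Cancelling the injective map of the common prefix leaves two tails coding the same point. *)
    apply: (word_map_inj (w := mkseq i (p n)) hf).
    by rewrite -(coding_map_shift _ _ hf invM) ij -IH -(coding_map_shift _ _ hf invM).
  (* The tail of [i] at [p n] starts with [w n], a word of Gamma. *)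
  have := iw n.+1; rewrite -/(p _) pS mkseqD mkseqS flatten_rcons iw => /eqP.
  by rewrite eqseq_cat// => /andP[_ /eqP ->].
(* Words of Gamma are nonempty, so the cut points are unbounded and the common prefixes exhaust both
   sequences. *)
have np n : (n <= p n)%N.
  elim: n => [//|n IH]; rewrite pS -addn1 leq_add//.
  by have [k _ /size_S_words ->] := Gw n.
apply/funext => n; have nlt : (n < p n.+1)%N by exact: np.
have := congr1 (fun s => nth (i n) s n) (eqp n.+1).
by rewrite !nth_mkseq.
Qed.

(** * Tails of codings and the dimension formula *)

Lemma univoque_shift (R : realType) (d m : nat)
    (f : 'I_m -> 'cV[R]_d -> 'cV[R]_d) (K : set 'cV[R]_d) (i : nat -> 'I_m)
    (p : nat) :
  (forall i, contractive_similitude (f i)) -> invariant_compact f K ->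
  univoque f K (coding_map f i) -> univoque f K (coding_map f (shift p i)).
Proof.
move=> hf invK [_ [i0 [_ iu]]]; split; first exact: coding_map_mem.
exists (shift p i); split=> // j ij.
(* Putting the first [p] letters of [i] before another coding [j] of the tail point gives a coding
   of the original point, which has only one. *)
pose j' n := if (n < p)%N then i n else j (n - p)%N.
have mj : mkseq j' p = mkseq i p.
  by apply/eq_in_map => n; rewrite mem_iota /j' => /andP[_ ->].
have sj : shift p j' = j.
  by apply/funext => n; rewrite /shift /j' ltnNge leq_addr addKn.
rewrite -(iu i)//; suff -> : i0 = j' by [].
apply: iu; rewrite (coding_map_shift j' p hf invK) mj sj ij.
by rewrite -(coding_map_shift i p hf invK).
Qed.

Lemma concatenations_or_V (R : realType) (d m : nat)
    (f : 'I_m -> 'cV[R]_d -> 'cV[R]_d) (M : set 'cV[R]_d) (i : nat -> 'I_m) :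
  concatenations (Gamma_words f M) i \/ exists p, V_seqs f M (shift p i).
Proof.
have [?|/forallNP nV] := pselect (exists p, V_seqs f M (shift p i)); first by right.
left; have /choice[k kP] : forall p, exists k,
    (1 <= k)%N /\ Gamma_words f M (mkseq (shift p i) k).
  by move=> p; apply: contrapT; exact: nV.
(* Greedy cutting: from each cut point, advance by the length [k] of a word of Gamma that starts the
   tail there. *)
pose p := fix p n := if n is n'.+1 then (p n' + k (p n'))%N else 0%N.
exists (fun n => mkseq (shift (p n) i) (k (p n))); split=> [n|n].
  by have [] := kP (p n).
suff <- : mkseq i (p n) = flatten (mkseq (fun n => mkseq (shift (p n) i) (k (p n))) n).
  by rewrite size_mkseq.
by elim: n => [//|n IH]; rewrite mkseqS flatten_rcons -IH /= mkseqD.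
Qed.

Theorem theorem1p1 (R : realType) (d m : nat) (hd : (1 <= d)%N) (hm : (1 <= m)%N)
    (f : 'I_m -> 'cV[R]_d -> 'cV[R]_d)
    (hf : forall i, contractive_similitude (f i))
    (K : set 'cV[R]_d) (hK : self_similar_set f K)
    (M : set 'cV[R]_d) (hM0 : M !=set0) (hMc : compact M)
    (hMf : forall i, f i @` M `<=` M) :
  hausdorff_dim (univoque f K) =
    maxe (hausdorff_dim (coding_map f @` concatenations (Gamma_words f M)))
         (hausdorff_dim (coding_map f @`
           (V_seqs f M `&` coding_map f @^-1` univoque f K))).
Proof.
have invM : invariant_compact f M by split.
have invK : invariant_compact f K.
  have [K0 cK fK] := hK; split=> // i x fix_; rewrite fK; exists i => //.
set A := coding_map f @` concatenations _; set B := coding_map f @` (_ `&` _).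
apply/le_anti/andP; split; last first.
  (* The lower bound is monotonicity: both sets are contained in the univoque set. *)
  rewrite ge_max; apply/andP; split; apply: hausdorff_dim_subset => x.
    move=> [i Gi <-]; split; first exact: coding_map_mem.
    exists i; split=> // j ij.
    exact: concatenations_coding_inj hf invM Gi (esym ij).
  by move=> [i [_ Ui] <-].
(* Finite words form a countable type, and [None] adds one index for [A], so a single countable
   union covers the univoque set. *)
pose F (o : option (seq 'I_m)) := if o is Some w then word_map f w @` B else A.
apply: (@le_trans _ _ (hausdorff_dim (\bigcup_o F o))).
  apply: hausdorff_dim_subset => x Ux; have [_ [i [ix _]]] := Ux.
  have [Gi|[p Vp]] := concatenations_or_V f M i.
    by exists None => //; exists i.
  exists (Some (mkseq i p)) => //=; exists (coding_map f (shift p i)).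
    exists (shift p i) => //; split=> //.
    by apply: univoque_shift => //; rewrite ix.
  by rewrite -(coding_map_shift i p hf invM).
apply: hausdorff_dim_bigcup_le => [|[w|]].
- by rewrite le_max hausdorff_dim_ge0.
- rewrite le_max; apply/orP; right.
  exact/hausdorff_dim_image/word_map_nonexpansive.
- by rewrite le_max lexx.
Qed.
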